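(* Let $b\geq 2$ be an integer. For all integers $n\geq 0$ and $k\geq 1$, \[ \bar{s}_b(n,n+bk)\leq \bar{s}_b(n,n+k)+\frac{b-1}{2}. \] Moreover, equality holds for every $k\geq1$ when $n=0$.
   Context: For an integer $b\geq 2$ and $n\in\mathbb{Z}_{\ge 0}$, $s_b(n)$ is the sum of the base-$b$ digits of $n$, and $S_b(N)=\sum_{n=0}^{N-1}s_b(n)$. For integers $0\leq s<t$, $\bar{s}_b(s,t)=\frac{S_b(t)-S_b(s)}{t-s}=\frac{1}{t-s}\sum_{r=s}^{t-1}s_b(r)$. *)

(* Defs.v *)
From mathcomp Require Export all_boot all_order all_algebra.

Set Implicit Arguments.
Unset Strict Implicit.
Unset Printing Implicit Defensive.

Import Order.TTheory GRing.Theory Num.Theory.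

Definition digit (b n i : nat) : nat := (n %/ b ^ i) %% b.

(* The bound [i < n] loses no digit when b >= 2, since then n < b ^ i for all
   i >= n; see [digit_eq0] and [digit_expansion]. *)
Definition digit_sum (b n : nat) : nat := \sum_(i < n) digit b n i.

Definition digit_sum_total (b N : nat) : nat := \sum_(0 <= n < N) digit_sum b n.

Definition mean_digit_sum (b s t : nat) : rat :=
  (((digit_sum_total b t)%:R - (digit_sum_total b s)%:R) / (t%:R - s%:R))%R.

Lemma digit_eq0 (b n i : nat) : 1 < b -> n <= i -> digit b n i = 0.
Proof.
move=> b_gt1 le_ni; rewrite /digit divn_small ?mod0n //.
exact: leq_ltn_trans le_ni (ltn_expl i b_gt1).
Qed.

Lemma digit_expansion (b n : nat) :
  1 < b -> n = \sum_(i < n) digit b n i * b ^ i.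
Proof.
move=> b_gt1.
have partial m : n = n %/ b ^ m * b ^ m + \sum_(i < m) digit b n i * b ^ i.
  elim: m => [|m IHm]; first by rewrite big_ord0 divn1 muln1 addn0.
  rewrite {1}IHm big_ord_recr /= addnCA addnC; congr (_ + _).
  rewrite {1}(divn_eq (n %/ b ^ m) b) mulnDl -divnMA -expnSr.
  by rewrite -mulnA -expnS.
by rewrite {1}(partial n) divn_small ?mul0n // ltn_expl.
Qed.

Lemma mean_digit_sumE (b s t : nat) : s < t ->
  mean_digit_sum b s t
    = ((\sum_(s <= r < t) digit_sum b r)%:R / (t - s)%:R)%R.
Proof.
move=> /ltnW le_st; rewrite /mean_digit_sum /digit_sum_total natrB //.
by rewrite (big_cat_nat (leq0n s) le_st) /= natrD addrAC subrr add0r.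
Qed.

(* Main.v *)
(* Write W(c, l) for the sum of the digit sums of c, ..., c + l - 1. Sorting a
   window by residues mod b gives W(bn, bk) = b W(n, k) + k b(b-1)/2, so the
   claim is W(n, bk) <= W(bn, bk), with equality at n = 0. More generally
   W(q, l) + max(c - bq, 0) <= W(c, l) whenever |c - bq| < b and l >= 1. This
   goes by induction on l = bD + u with 1 <= u <= b: for each j < b the terms
   c + j, c + j + b, ... have quotients forming a window at (c + j) %/ b of
   length D or D + 1, and (c + j) %/ b is again within b of b ((q + j) %/ b).
   The slack max(c - bq, 0) absorbs the difference between the remainders of
   the u leftover terms. *)
Require Import Defs.
From mathcomp Require Import zify ring lra.
Import Order.TTheory GRing.Theory Num.Theory.

(** * Window sums and their splitting by residues *)

Definition window_sum (b c l : nat) : nat := \sum_(i < l) digit_sum b (c + i).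

Lemma digit_sum_widen (b n m : nat) :
  1 < b -> n <= m -> digit_sum b n = \sum_(i < m) digit b n i.
Proof.
move=> b_gt1 /subnKC <-; rewrite big_split_ord /= [X in _ + X]big1 ?addn0 //.
by move=> i _; rewrite digit_eq0 ?leq_addr.
Qed.

Lemma digit_sum_rec (b n : nat) :
  1 < b -> digit_sum b n = digit_sum b (n %/ b) + n %% b.
Proof.
(* Padding to [n.+1] and [n] digits makes the two sums match once the units digit is removed. *)
move=> b_gt1; rewrite (digit_sum_widen b n n.+1) // (digit_sum_widen b _ n) //;
  last exact: leq_div.
rewrite big_ord_recl /= /digit expn0 divn1 addnC; congr (_ + _).
by apply: eq_bigr => i _; rewrite /bump /= add1n expnS divnMA.
Qed.

Lemma digit_sum_add_mul (b c i j : nat) : 1 < b ->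
  digit_sum b (c + (b * i + j)) = digit_sum b ((c + j) %/ b + i) + (c + j) %% b.
Proof.
move=> b_gt1; rewrite digit_sum_rec // addnCA mulnC divnMDl ?modnMDl; last lia.
by rewrite [i + _]addnC.
Qed.

Lemma sum_split_residues (F : nat -> nat) (b D u : nat) : u <= b ->
  \sum_(i < b * D + u) F i = \sum_(j < b) \sum_(i < D + (j < u)) F (b * i + j).
Proof.
move=> le_ub.
have -> : \sum_(j < b) \sum_(i < D + (j < u)) F (b * i + j) =
    \sum_(j < b) \sum_(i < D) F (b * i + j) + \sum_(j < u) F (b * D + j).
  rewrite (big_ord_widen b (fun j => F (b * D + j)) le_ub) [X in _ + X]big_mkcond.
  rewrite -big_split; apply: eq_bigr => j _ /=.
  by case: (j < u); rewrite ?addn1 ?addn0 ?big_ord_recr /= ?addn0.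
rewrite big_split_ord /=; congr (_ + _).
rewrite exchange_big /=.
elim: D => [|D IH]; first by rewrite muln0 !big_ord0.
by rewrite mulnSr big_split_ord big_ord_recr /= IH.
Qed.

(** Passing from [c] to [c + 1] trades the term [c %% b] for [(c + b) %% b], which is equal. *)
Lemma sum_residues (b c : nat) : \sum_(j < b) (c + j) %% b = \sum_(j < b) j.
Proof.
elim: c => [|c <-]; first by apply: eq_bigr => j _; rewrite add0n modn_small.
case: b => [|b]; first by rewrite !big_ord0.
rewrite big_ord_recr big_ord_recl /= addn0 addnC addSnnS modnDr.
by congr (_ + _); apply: eq_bigr => j _; rewrite /bump /= addSnnS.
Qed.

(** The terms in the class of [j] share the remainder [(c + j) %% b]. Over all [j < b] these
    remainders run through every residue, once for each of the [D] full rounds; the last sum comes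
    from the leftover terms. *)
Lemma window_sum_split (b c D u : nat) : 1 < b -> u <= b ->
  window_sum b c (b * D + u) =
    \sum_(j < b) window_sum b ((c + j) %/ b) (D + (j < u))
    + D * \sum_(j < b) j + \sum_(j < u) (c + j) %% b.
Proof.
move=> b_gt1 le_ub.
rewrite /window_sum (sum_split_residues (fun i => digit_sum b (c + i))) //.
rewrite -(sum_residues b c) big_distrr /=.
rewrite (big_ord_widen b (fun j => (c + j) %% b) le_ub) [X in _ + X]big_mkcond.
rewrite -!big_split; apply: eq_bigr => j _ /=.
under eq_bigr => i _ do rewrite digit_sum_add_mul //.
rewrite big_split /= sum_nat_const card_ord -addnA; congr (_ + _).
by case: (j < u); rewrite ?mulnDl ?mul1n ?addn0.
Qed.

(** * Step functions, carries and near multiples *)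

(** [minn u x] and [minn u y] count the indices [j < u] below each breakpoint. *)
Lemma sum_three_steps (F : nat -> int) (x y u : nat) (A B C : int) :
  x <= y ->
  (forall j, j < u ->
    ((if (j < x)%N then A else if (j < y)%N then B else C) <= F j)%R) ->
  (A * (minn u x)%:R + B * ((minn u y)%:R - (minn u x)%:R)
     + C * (u%:R - (minn u y)%:R) <= \sum_(j < u) F j)%R.
Proof.
move=> le_xy; elim: u => [|u IH] leF; first by rewrite big_ord0 !min0n; lia.
rewrite big_ord_recr /=.
have {}IH := IH (fun j lt_ju => leF j (ltnW lt_ju)).
have := leF u (ltnSn u).
case: ltnP => ux; [|case: ltnP => uy] => leFu; move: IH.
- rewrite (minn_idPl (ltnW ux)) (minn_idPl ux).
  rewrite (minn_idPl (leq_trans (ltnW ux) le_xy)) (minn_idPl (leq_trans ux le_xy)).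
  rewrite -!natr1; lra.
- rewrite (minn_idPr ux) (minn_idPr (leqW ux)).
  rewrite (minn_idPl (ltnW uy)) (minn_idPl uy); rewrite -!natr1; lra.
- rewrite (minn_idPr ux) (minn_idPr (leqW ux)).
  rewrite (minn_idPr uy) (minn_idPr (leqW uy)); rewrite -!natr1; lra.
Qed.

Lemma divn_modn_shift (b a r j : nat) : r < b -> j < b ->
  (b * a + r + j) %/ b = a + (b <= r + j) /\
  (b * a + r + j) %% b = r + j - b * (b <= r + j).
Proof.
move=> lt_rb lt_jb; have b_gt0 : 0 < b by lia.
rewrite -addnA mulnC divnMDl // modnMDl.
case: leqP => [le_b|lt_b].
  rewrite -(subnK le_b) divnDr // modnDr divnn b_gt0 divn_small ?modn_small; lia.
by rewrite divn_small // modn_small //; lia.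
Qed.

Definition near_multiple (b q c : nat) : bool := (c < b * q + b) && (b * q < c + b).

(** In [NearBelow], [c] is [b * q - f], written so that its quotient [q1] and remainder [b - f] are
    visible. *)
Variant near_multiple_spec (b q c : nat) : Prop :=
| NearAbove e of e < b & c = b * q + e
| NearBelow q1 f of 0 < f & f < b & q = q1.+1 & c = b * q1 + (b - f).

Lemma near_multipleP (b q c : nat) : near_multiple b q c -> near_multiple_spec b q c.
Proof.
case/andP=> ub lb; have [le_c|lt_c] := leqP (b * q) c.
  by apply: (NearAbove _ _ _ (c - b * q)); lia.
case: q ub lb lt_c => [|q1] ub lb lt_c; first by rewrite muln0 in lt_c.
by apply: (NearBelow _ _ _ q1 (b * q1.+1 - c)); rewrite ?mulnS in ub lb lt_c *; lia.
Qed.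

(** With [q = b * p + r], the new difference is [r] ([r - 1] if [c < b * q]) plus the carry in
    [c + j], minus [b] times the carry in [q + j]. The carries keep it off [b] and [-b]: [r = b - 1]
    without a carry in [q + j] forces [j = 0], and [r = 1] with one forces [j = b - 1]. *)
Lemma near_multiple_shift (b q c j : nat) : 1 < b -> j < b ->
  near_multiple b q c -> near_multiple b ((q + j) %/ b) ((c + j) %/ b).
Proof.
move=> b_gt1 lt_jb /near_multipleP near.
have lt_rb : q %% b < b by rewrite ltn_mod; lia.
have := divn_eq q b; rewrite mulnC.
move: (q %/ b) (q %% b) lt_rb => p r lt_rb eq_q.
have [Q _] := divn_modn_shift _ p _ _ lt_rb lt_jb; rewrite eq_q Q /near_multiple.
case: near => [e lt_eb ->|q1 f f_gt0 lt_fb eq_q1 ->].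
  have [-> _] := divn_modn_shift _ q _ _ lt_eb lt_jb.
  by rewrite mulnDr; case: leqP => ?; case: leqP => ?; lia.
have lt_fb' : b - f < b by lia.
have [-> _] := divn_modn_shift _ q1 _ _ lt_fb' lt_jb.
by rewrite mulnDr; case: leqP => ?; case: leqP => ?; lia.
Qed.

(* The subtractions are truncated: they stand for the positive parts
   max(c - bq, 0) and max((c + j) %/ b - b ((q + j) %/ b), 0). *)
Lemma residue_balance (b q c u : nat) : 1 < b -> 0 < u <= b ->
  near_multiple b q c ->
  \sum_(j < u) (q + j) %% b + (c - b * q) <=
  \sum_(j < u) ((c + j) %/ b - b * ((q + j) %/ b) + (c + j) %% b).
Proof.
move=> b_gt1 /andP[u_gt0 le_ub] /near_multipleP near.
(* F takes three constant values on consecutive ranges of j, so that its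
   partial sums are piecewise linear and extremal at the breakpoints. *)
pose F j : int := (((c + j) %/ b - b * ((q + j) %/ b) + (c + j) %% b)%N%:R
                  - ((q + j) %% b)%N%:R)%R.
suff: ((c - b * q)%N%:R <= \sum_(j < u) F j)%R.
  by rewrite /F sumrB -!natr_sum lerBrDr -natrD ler_nat addnC.
have lt_rb : q %% b < b by rewrite ltn_mod; lia.
have := divn_eq q b; rewrite mulnC.
move: (q %/ b) (q %% b) lt_rb => p r lt_rb eq_q.
case: near => [e lt_eb eq_c|q1 f f_gt0 lt_fb eq_q1 eq_c].
  have -> : c - b * q = e by lia.
  have steps j : j < u -> ((r + (b <= e + j) - b * (b <= r + j)
      + (e + j - b * (b <= e + j)))%N%:R
     - (r + j - b * (b <= r + j))%N%:R <= F j)%R.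
    move=> lt_ju; have lt_jb : j < b by lia.
    rewrite /F; have [Q1 Q2] := divn_modn_shift _ p _ _ lt_rb lt_jb.
    have [C1 C2] := divn_modn_shift _ q _ _ lt_eb lt_jb.
    rewrite {1 2}eq_c C1 C2 eq_q Q1 Q2 mulnDr.
    by case: leqP => ?; case: leqP => ?; lia.
  (* [q + j] carries from [j = b - r] on and [c + j] from [j = b - e] on; the order of [e] and [r]
     decides which comes first. *)
  have [le_er|lt_re] := leqP e r.
    apply: le_trans
      (sum_three_steps F (b - r) (b - e) u e%:R%R
         (e%:R - r%:R + b%:R)%R (e%:R - r%:R)%R _ _); first last.
    - move=> j lt_ju; apply: le_trans (steps j lt_ju).
      by case: ltnP => ?; [|case: ltnP => ?]; case: leqP => ?; case: leqP => ?; lia.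
    - lia.
    case: (leqP u (b - r)) => ?; [|case: (leqP u (b - e)) => ?]; nia.
  apply: le_trans
      (sum_three_steps F (b - e) (b - r) u e%:R%R
         (e%:R + 1 - b%:R)%R (e%:R - r%:R)%R _ _); first last.
  - move=> j lt_ju; apply: le_trans (steps j lt_ju).
    by case: ltnP => ?; [|case: ltnP => ?]; case: leqP => ?; case: leqP => ?; lia.
  - lia.
  (* The bound can decrease in [u] only between the breakpoints; at [u = b - r] it is
     [e * (b - e) - (b - 1 - e) * (e - r)], still at least [e]. *)
  case: (leqP u (b - e)) => ?; [|case: (leqP u (b - r)) => ?]; nia.
have -> : c - b * q = 0 by rewrite eq_q1 mulnS; lia.
have lt_fb' : b - f < b by lia.
have steps j : j < u -> ((r + (b <= b - f + j) - 1 - b * (b <= r + j)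
    + (b - f + j - b * (b <= b - f + j)))%N%:R
   - (r + j - b * (b <= r + j))%N%:R <= F j)%R.
  move=> lt_ju; have lt_jb : j < b by lia.
  rewrite /F; have [Q1 Q2] := divn_modn_shift _ p _ _ lt_rb lt_jb.
  have [C1 C2] := divn_modn_shift _ q1 _ _ lt_fb' lt_jb.
  rewrite {1 2}eq_c C1 C2 eq_q Q1 Q2 mulnDr.
  by case: leqP => ?; case: leqP => ?; lia.
(* Now [c + j] carries from [j = f] on. The term [(0 < r)] below reflects the truncation of [r - 1]
   at [r = 0]. *)
have [le_f|lt_f] := leqP f (b - r).
  apply: le_trans
      (sum_three_steps F f (b - r) u (b%:R - f%:R - (0 < r)%N%:R)%R
         (- f%:R)%R (b%:R - f%:R - r%:R)%R _ _); first last.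
  - move=> j lt_ju; apply: le_trans (steps j lt_ju).
    by case: ltnP => ?; [|case: ltnP => ?]; case: leqP => ?; case: leqP => ?; lia.
  - lia.
  case: (leqP u f) => ?; [|case: (leqP u (b - r)) => ?]; nia.
apply: le_trans
      (sum_three_steps F (b - r) f u (b%:R - f%:R - 1)%R
         (2%:R * b%:R - f%:R - r%:R)%R (b%:R - f%:R - r%:R)%R _ _); first last.
- move=> j lt_ju; apply: le_trans (steps j lt_ju).
  by case: ltnP => ?; [|case: ltnP => ?]; case: leqP => ?; case: leqP => ?; lia.
- lia.
case: (leqP u (b - r)) => ?; [|case: (leqP u f) => ?]; nia.
Qed.

(** * Comparison of window sums *)

(** A carry turns the last digit into 0 and passes the increment to the quotient, where induction
    applies. *)
Lemma digit_sum_succ (b n : nat) : 1 < b -> digit_sum b n.+1 <= (digit_sum b n).+1.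
Proof.
move=> b_gt1; have [m] := ubnP n; elim: m n => // m IH n lt_nm.
have lt_rb : n %% b < b by rewrite ltn_mod; lia.
have [/= D M] := divn_modn_shift _ (n %/ b) _ _ lt_rb b_gt1.
move: D M; rewrite mulnC -divn_eq addn1 => D M.
rewrite digit_sum_rec // [digit_sum b n]digit_sum_rec // D M.
case: (leqP b (n %% b + 1)) => le_b; last by rewrite /= addn0; lia.
have n_gt0 : 0 < n by case: (n) lt_rb le_b => //; rewrite mod0n; lia.
have lt_n : n %/ b < m by apply: leq_trans (ltn_Pdiv b_gt1 n_gt0) _; lia.
by have := IH _ lt_n; rewrite /= addn1; lia.
Qed.

(** The base case, windows of length 1. Above [b * q], the slack is the last digit of [c]; below,
    the slack is 0 and the last digit [b - f >= 1] covers the growth of the digit sum from [q1] to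
    [q1.+1]. *)
Lemma digit_sum_near_multiple (b q c : nat) : 1 < b -> near_multiple b q c ->
  digit_sum b q + (c - b * q) <= digit_sum b c.
Proof.
move=> b_gt1 /near_multipleP[e lt_eb ->|q1 f f_gt0 lt_fb -> ->];
  rewrite [X in _ <= X]digit_sum_rec // mulnC divnMDl ?modnMDl; try lia.
  by rewrite divn_small // modn_small // addn0; lia.
have lt_b : b - f < b by lia.
rewrite divn_small // modn_small // addn0.
by have := digit_sum_succ b q1 b_gt1; rewrite mulnS; lia.
Qed.

Lemma window_sum_near_multiple (b q c l : nat) : 1 < b -> 0 < l ->
  near_multiple b q c -> window_sum b q l + (c - b * q) <= window_sum b c l.
Proof.
move=> b_gt1; have [m] := ubnP l; elim: m l q c => // m IH l q c lt_lm l_gt0 near.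
have [->|l_neq1] := eqVneq l 1.
  by rewrite /window_sum !big_ord_recl !big_ord0 !addn0 digit_sum_near_multiple.
(* [u] ranges over 1 to [b], so there is always a leftover term for [residue_balance] to draw the
   slack from. *)
pose D := l.-1 %/ b; pose u := (l.-1 %% b).+1.
have le_ub : u <= b by rewrite ltn_mod; lia.
have def_l : l = b * D + u by have := divn_eq l.-1 b; rewrite /D /u mulnC; lia.
have lt_Dm : D.+1 < m.
  have : D < l.-1 by apply: ltn_Pdiv; lia.
  by lia.
(* Only the windows of length [D + 1] keep their slack; those of length [D] may be empty. *)
have windows : \sum_(j < b) window_sum b ((q + j) %/ b) (D + (j < u))
    + \sum_(j < u) ((c + j) %/ b - b * ((q + j) %/ b))
    <= \sum_(j < b) window_sum b ((c + j) %/ b) (D + (j < u)).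
  rewrite (big_ord_widen b (fun j => (c + j) %/ b - b * ((q + j) %/ b)) le_ub).
  rewrite [X in _ + X]big_mkcond -big_split; apply: leq_sum => j _ /=.
  have near_j := near_multiple_shift _ _ _ _ b_gt1 (ltn_ord j) near.
  case: (j < u); first by rewrite addn1 IH.
  rewrite !addn0; case: (posnP D) => [->|D_gt0]; first by rewrite /window_sum !big_ord0.
  by apply: leq_trans (IH D _ _ _ D_gt0 near_j); rewrite ?leq_addr //; lia.
have := residue_balance b q c u b_gt1 le_ub near.
rewrite big_split /= def_l !window_sum_split //; move: windows.
do 6!move: (\sum_(_ < _) _) => ?; lia.
Qed.

(** * From window sums to means *)

Lemma window_sum_total (b n l : nat) :
  digit_sum_total b (n + l) = digit_sum_total b n + window_sum b n l.
Proof.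
rewrite /digit_sum_total (big_cat_nat (leq0n n) (leq_addr l n)); congr (_ + _).
by rewrite -[X in index_iota X _]add0n big_addn addKn big_mkord; apply: eq_bigr => i _; rewrite addnC.
Qed.

Lemma mean_digit_sum_window (b n l : nat) :
  mean_digit_sum b n (n + l) = ((window_sum b n l)%:R / l%:R)%R.
Proof.
rewrite /mean_digit_sum window_sum_total !natrD !(addrC n%:R%R) addrK.
by rewrite [(_ + (window_sum _ _ _)%:R)%R]addrC addrK.
Qed.

(** All [b * n + j] with [j < b] have quotient [n], so every class gives the same window. Doubling
    keeps the term [k * b(b-1)/2] free of division. *)
Lemma double_window_sum_mul (b n k : nat) : 1 < b ->
  2 * window_sum b (b * n) (b * k) = 2 * (b * window_sum b n k) + k * (b * b.-1).
Proof.
move=> b_gt1; rewrite -[b * k]addn0 window_sum_split // big_ord0 addn0.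
have -> : \sum_(j < b) window_sum b ((b * n + j) %/ b) (k + (j < 0))
    = b * window_sum b n k.
  rewrite (eq_bigr (fun=> window_sum b n k)) ?sum_nat_const ?card_ord // => j _.
  by rewrite ltn0 addn0 mulnC divnMDl ?divn_small ?addn0 ?ltn_ord // ltnW.
have := bin2_sum b; rewrite big_mkord => ->.
by rewrite mulnDr (mulnCA 2 k) -(mul_bin_diag b 1) bin1.
Qed.

Theorem theorem4 (b : nat) (hb : (2 <= b)%N) :
  (forall n k : nat, (1 <= k)%N ->
     (mean_digit_sum b n (n + b * k) <=
        mean_digit_sum b n (n + k) + (b%:R - 1) / 2%:R)%R) /\
  (forall k : nat, (1 <= k)%N ->
     (mean_digit_sum b 0 (0 + b * k) =
        mean_digit_sum b 0 (0 + k) + (b%:R - 1) / 2%:R)%R).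
Proof.
(* The right-hand side of the claim is itself a mean, over the window of length [b * k] starting at
   [b * n]. *)
have scaled_mean n k : 0 < k ->
  ((window_sum b (b * n) (b * k))%:R / (b * k)%:R
    = mean_digit_sum b n (n + k) + (b%:R - 1) / 2%:R)%R.
  move=> k_gt0; rewrite mean_digit_sum_window.
  have b_gt0 : 0 < b by apply: ltnW.
  have /(congr1 (fun x => x%:R : rat)%R) := double_window_sum_mul b n k hb.
  rewrite natrD !natrM -subn1 natrB // => eqW.
  have nz_k : (k%:R != 0 :> rat)%R by rewrite pnatr_eq0 -lt0n.
  have nz_b : (b%:R != 0 :> rat)%R by rewrite pnatr_eq0 -lt0n.
  have -> : ((window_sum b (b * n) (b * k))%:R =
    b%:R * (window_sum b n k)%:R + k%:R * (b%:R * (b%:R - 1)) / 2%:R :> rat)%R by lra.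
  by field; rewrite nz_k nz_b.
split=> [n k k_gt0|k k_gt0]; last first.
  (* As [b * 0 = 0], the scaled window is the given one. *)
  by rewrite -scaled_mean // muln0 mean_digit_sum_window.
rewrite -scaled_mean // mean_digit_sum_window ler_wpM2r ?invr_ge0 ?ler0n // ler_nat.
have near : near_multiple b n (b * n) by rewrite /near_multiple; lia.
have bk_gt0 : 0 < b * k by rewrite muln_gt0; lia.
exact: leq_trans (leq_addr _ _) (window_sum_near_multiple _ _ _ _ hb bk_gt0 near).
Qed.
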